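(* Let $g\ge3$ and $2\le k<g$ be integers, and let $N=\sum_{i=0}^{n-1}a_ig^i$ (digits $0\le a_i<g$, $a_{n-1}\ne0$) be a $(g,k)$-reverse multiple. Then $a_0+a_{n-1}\le g$. Moreover, if $a_0+a_{n-1}=g$, then $k+1$ divides $g$.
   Context: A positive integer $N=\sum_{i=0}^{n-1}a_ig^i$ with base-$g$ digits $0\le a_i<g$ and $a_{n-1}\ne 0$ is a $(g,k)$-reverse multiple if $kN=\sum_{i=0}^{n-1}a_{n-1-i}g^i$, i.e. $k$ times $N$ equals the number whose base-$g$ digit string is that of $N$ reversed. *)

(* Defs.v *)
From mathcomp Require Import all_boot.
Set Implicit Arguments.
Unset Strict Implicit.
Unset Printing Implicit Defensive.

(* Only the values [a i] with [i < n] are digits. The guard [0 < n] makes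
   [n.-1] the true index of the leading digit. *)
Definition base_digits (g n : nat) (a : nat -> nat) (N : nat) : Prop :=
  [/\ 0 < n,
      forall i, i < n -> a i < g,
      a n.-1 <> 0 &
      N = \sum_(i < n) a i * g ^ i].

Definition reverse_multiple (g k N : nat) : Prop :=
  exists (n : nat) (a : nat -> nat),
    base_digits g n a N /\ k * N = \sum_(i < n) a (n.-1 - i) * g ^ i.

(* Main.v *)
Require Import Defs.
From mathcomp Require Import all_boot.
From mathcomp Require Import zify.

Set Implicit Arguments.
Unset Strict Implicit.

(** Let [b] be the last and [t] the leading digit of [N]. Comparing last digits
of [k * N] and the reversal gives [k * b = t + r * g] with [r < k]; comparing
leading digits gives [k * t <= b]. Writing [b = k * t + c], this yields
[(k - 1) * (t + b) = r * g - c <= (k - 1) * g], hence [t + b <= g]; equality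
forces [c = 0], so that [g = t + b = (k + 1) * t]. *)

Lemma digit_sum_lt (g n : nat) (a : nat -> nat) :
  (forall i, i < n -> a i < g) -> \sum_(i < n) a i * g ^ i < g ^ n.
Proof.
elim: n => [_|n IHn a_lt]; first by rewrite big_ord0.
have sum_lt : \sum_(i < n) a i * g ^ i < g ^ n.
  by apply: IHn => i lt_in; apply: a_lt; apply: ltnW.
rewrite big_ord_recr /=; apply: (@leq_trans ((a n).+1 * g ^ n)).
  by rewrite mulSn ltn_add2r.
by rewrite expnS leq_mul2r a_lt ?orbT.
Qed.

Lemma digit_sum_mod (g n : nat) (a : nat -> nat) :
  0 < n -> a 0 < g -> (\sum_(i < n) a i * g ^ i) %% g = a 0.
Proof.
case: n => // n _ a0_lt; rewrite big_ord_recl expn0 muln1.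
have /dvdnP [q ->] : g %| \sum_(i < n) a (lift ord0 i) * g ^ (lift ord0 i).
  by apply: dvdn_sum => i _; rewrite dvdn_mull // expnS dvdn_mulr.
by rewrite addnC modnMDl modn_small.
Qed.

Lemma digit_sum_div (g n : nat) (a : nat -> nat) :
  0 < n -> (forall i, i < n -> a i < g) ->
  (\sum_(i < n) a i * g ^ i) %/ g ^ n.-1 = a n.-1.
Proof.
case: n => // n _ a_lt /=; have g_gt0 : 0 < g by apply: leq_ltn_trans (a_lt 0 _).
rewrite big_ord_recr /= addnC divnMDl ?expn_gt0 ?g_gt0 // divn_small ?addn0 //.
by apply: digit_sum_lt => i lt_in; apply: a_lt; apply: ltnW.
Qed.

(** A nonzero leading digit forces [g ^ n.-1 <= N < g ^ n]. Since [reverse_multiple] hides its own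
    length and digits, this is what lets them be matched with a given expansion of [N]. *)
Lemma base_digits_size (g n N : nat) (a : nat -> nat) :
  1 < g -> base_digits g n a N -> n = (trunc_log g N).+1.
Proof.
move=> g_gt1 [n_gt0 a_lt /eqP lead_neq0 def_N].
rewrite -(prednK n_gt0); congr _.+1; apply/esym/trunc_log_eq => //.
rewrite prednK // {2}def_N digit_sum_lt // andbT.
by rewrite -divn_gt0 ?expn_gt0 ?(ltnW g_gt1) // def_N digit_sum_div // lt0n.
Qed.

Unset Implicit Arguments.

Theorem theorem4 (g k N n : nat) (a : nat -> nat)
  (hg : 3 <= g) (hk : 2 <= k) (hkg : k < g)
  (hdig : base_digits g n a N) (hrev : reverse_multiple g k N) :
  a 0 + a n.-1 <= g /\ (a 0 + a n.-1 = g -> k.+1 %| g).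
Proof.
have g_gt1 : 1 < g by apply: ltnW.
have [m [b [b_digits kN]]] := hrev.
have eq_mn : m = n.
  by rewrite (base_digits_size g_gt1 hdig) (base_digits_size g_gt1 b_digits).
move: hdig b_digits; rewrite {m}eq_mn in kN *.
move=> [n_gt0 a_lt _ def_N] [_ b_lt _ def_N'].
(* Both extreme digits can be read off [N] itself, by remainder and quotient. *)
have -> : a 0 = b 0.
  by rewrite -(digit_sum_mod n_gt0 (a_lt _ n_gt0)) -def_N def_N' digit_sum_mod ?b_lt.
have -> : a n.-1 = b n.-1.
  by rewrite -(digit_sum_div n_gt0 a_lt) -def_N def_N' digit_sum_div.
(* The digits of [k * N], so that its extreme digits can be read off in the same way. *)
pose b' i := b (n.-1 - i).
have b'_lt i : i < n -> b' i < g by move=> _; apply: b_lt; lia.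
have kb_mod : (k * b 0) %% g = b n.-1.
  have := digit_sum_mod n_gt0 (b'_lt 0 n_gt0).
  rewrite /b' -kN subn0 => <-.
  by rewrite -[RHS]modnMmr def_N' digit_sum_mod ?b_lt // modnMmr.
have kt_le : k * b n.-1 <= b 0.
  have := digit_sum_div n_gt0 b'_lt.
  rewrite /b' -kN subnn => <-.
  rewrite -(digit_sum_div n_gt0 b_lt) -def_N' leq_divRL ?expn_gt0 ?(ltnW g_gt1) //.
  (* Multiplying a rounded-down quotient of [N] by [k] cannot exceed the quotient of [k * N]. *)
  by rewrite -mulnA leq_mul2l leq_divM orbT.
have b0_lt := b_lt 0 n_gt0.
have := divn_eq (k * b 0) g; rewrite kb_mod.
have : (k * b 0) %/ g < k.
  by rewrite ltn_divLR ?(ltnW g_gt1) // ltn_mul2l b0_lt andbT; lia.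
move: (_ %/ _) => r r_lt kx.
move: (b 0) (b n.-1) kt_le kx {kb_mod b0_lt} => x t kt_le kx.
have rg_le : r * g <= k.-1 * g by rewrite leq_mul2r; apply/orP; right; lia.
case: k hk kt_le rg_le kx {hkg hrev kN r_lt} => // k k_gt0 kt_le /= rg_le kx.
(* Here [k] stands for the former [k.-1]. The truncated difference is the [c] of the overview, exact
   by [kt_le], and the left side equals [r * g]. *)
have sum_le : k * (x + t) + (x - k.+1 * t) <= k * g by lia.
split; first by rewrite -(leq_pmul2l (k_gt0 : 0 < k)) (leq_trans (leq_addr _ _) sum_le).
(* With [x + t = g], [sum_le] leaves no room for [c]: [x = k.+1 * t], so [g = k.+2 * t]. *)
move=> sum_eq; apply/dvdnP; exists t; rewrite sum_eq in sum_le; lia.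
Qed.
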